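(* Let $f(x)=\frac1n\sum_{i=1}^n f_i(x)$ on $\mathbb{R}^d$ with each $f_i$ convex and $L$-smooth, and let $x_0$ satisfy $\|x_0-x^\star\|\le R_0$ for some minimizer $x^\star$ of $f$. Consider Algorithm R-Acc-SVRG-G (described in the context) run in the IDC mode with accuracy $\epsilon>0$, $\delta_0=L$ and $\beta>1$. Let $q\in(0,1)$, $\delta^\star_{\rm IDC}=\frac{\epsilon q}{2R_0}$, assume $\epsilon$ is small enough that $\delta^\star_{\rm IDC}\le L$, and let $\ell$ be the first outer iteration with $\delta_\ell\le\delta^\star_{\rm IDC}$. Then (i) at outer iteration $\ell$, the algorithm terminates with probability at least $1-q$; (ii) the total expected oracle complexity of the $\ell+1$ outer loops is $$O\!\left(\Big(n\log\frac{LR_0}{\epsilon q}+\sqrt{\frac{nLR_0}{\epsilon q}}\Big)\log\frac{LR_0}{\epsilon q}\right)$$ (with $\beta$ treated as a constant).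
   Context: R-Acc-SVRG-G: input $\epsilon>0$, $\delta_0=L$, $\beta>1$, $x_0$. For outer iterations $t=0,1,2,\dots$: define $f_i^{\delta_t}(x)=f_i(x)+\frac{\delta_t}2\|x-x_0\|^2$, $f^{\delta_t}=\frac1n\sum_i f_i^{\delta_t}$; set $p=\frac1n$, $\alpha$ the unique positive root of $\big(1-\frac{p(\alpha+\delta_t)}{\alpha+L+\delta_t}\big)\big(1+\frac{\delta_t}{\alpha}\big)^2=1$, $\tau_x=\frac{\alpha+\delta_t}{\alpha+L+\delta_t}$, $\tau_z=\frac{\tau_x}{\delta_t}-\frac{\alpha(1-\tau_x)}{\delta_tL}$, $C_{\rm IDC}=L^2+\frac{L\alpha^2p}{L+(1-p)(\alpha+\delta_t)}$, $C_{\rm IFC}=2L+\frac{2L\alpha^2p}{(L+(1-p)(\alpha+\delta_t))\delta_t}$; initialize $z_0=\tilde x_0=x_0$. Inner loop $k=0,1,\dots$: $y_k=\tau_xz_k+(1-\tau_x)\tilde x_k+\tau_z(\delta_t(\tilde x_k-z_k)-\nabla f^{\delta_t}(\tilde x_k))$; $z_{k+1}=\arg\min_x\{\langle\mathcal G^{\delta_t}_k,x\rangle+\frac\alpha2\|x-z_k\|^2+\frac{\delta_t}2\|x-y_k\|^2\}$ with $\mathcal G^{\delta_t}_k=\nabla f^{\delta_t}_{i_k}(y_k)-\nabla f^{\delta_t}_{i_k}(\tilde x_k)+\nabla f^{\delta_t}(\tilde x_k)$, $i_k$ uniform on $\{1,\dots,n\}$; $\tilde x_{k+1}=y_k$ with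 probability $p$, else $\tilde x_k$; if $\|\nabla f(\tilde x_k)\|\le\epsilon$, output $\tilde x_k$ and terminate; in IDC mode, if $(1+\frac{\delta_t}\alpha)^k\ge\sqrt{C_{\rm IDC}}/\delta_t$, break the inner loop; in IFC mode, if $(1+\frac{\delta_t}\alpha)^k\ge\sqrt{C_{\rm IFC}/(2\delta_t)}$, break the inner loop. After the inner loop, set $\delta_{t+1}=\delta_t/\beta$. Oracle complexity is the expected number of component gradient evaluations $\nabla f_i$ (a full gradient costs $n$). *)

(* Defs.v *)
From mathcomp Require Import all_boot all_order all_algebra.
From mathcomp Require Import all_classical all_reals all_analysis.
Import Order.TTheory GRing.Theory Num.Theory.
Import numFieldNormedType.Exports.

Set Implicit Arguments.
Unset Strict Implicit.
Unset Printing Implicit Defensive.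

Local Open Scope ring_scope.

Section Geometry.
Variables (R : realType) (d : nat).
Local Notation vec := 'rV[R]_d.

Definition dotv (u v : vec) : R := \sum_(j < d) u ord0 j * v ord0 j.
Definition enorm (v : vec) : R := Num.sqrt (dotv v v).

Definition convex_fun (h : vec -> R) : Prop :=
  forall (x y : vec) (t : R), 0 <= t <= 1 ->
    h (t *: x + (1 - t) *: y) <= t * h x + (1 - t) * h y.

Definition is_gradient (h : vec -> R) (gh : vec -> vec) : Prop :=
  forall x : vec, differentiable h x /\ 'd h x =1 (fun v => dotv (gh x) v).

Definition L_smooth (L : R) (h : vec -> R) (gh : vec -> vec) : Prop :=
  is_gradient h gh /\ forall x y : vec, enorm (gh x - gh y) <= L * enorm (x - y).

End Geometry.

Section Algorithm.
Variables (R : realType) (d n : nat).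
Local Notation vec := 'rV[R]_d.
(* g i = gradient of the component f_i *)
Variables (g : 'I_n -> vec -> vec) (L eps beta : R) (x0 : vec).

Definition pp : R := n%:R^-1.

Definition delta (t : nat) : R := L / beta ^+ t.

Definition alpha_eq (dl a : R) : Prop :=
  (1 - pp * (a + dl) / (a + L + dl)) * (1 + dl / a) ^+ 2 = 1.

(* the unique positive root *)
Definition alpha (t : nat) : R :=
  xget 1 [set a : R | 0 < a /\ alpha_eq (delta t) a].

Definition tau_x (t : nat) : R :=
  (alpha t + delta t) / (alpha t + L + delta t).

Definition tau_z (t : nat) : R :=
  tau_x t / delta t - alpha t * (1 - tau_x t) / (delta t * L).

Definition C_IDC (t : nat) : R :=
  L ^+ 2 + L * alpha t ^+ 2 * pp / (L + (1 - pp) * (alpha t + delta t)).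

Definition brk (t k : nat) : bool :=
  Num.sqrt (C_IDC t) / delta t <= (1 + delta t / alpha t) ^+ k.

Definition Kt (t : nat) : nat :=
  xget 0%N [set k : nat | brk t k /\ forall k', (k' < k)%N -> ~~ brk t k'].

Definition gradf (x : vec) : vec := pp *: \sum_(i < n) g i x.
Definition gradi_d (t : nat) (i : 'I_n) (x : vec) : vec :=
  g i x + delta t *: (x - x0).
Definition gradf_d (t : nat) (x : vec) : vec :=
  pp *: \sum_(i < n) gradi_d t i x.

(* one inner iteration: from (z_k, xt_k) with sampled index i = i_k and
   coin j (x~ is updated iff j = 0, i.e. with probability p = 1/n).
   z_{k+1} is the (closed form of the) argmin of
   <G,x> + alpha/2 |x - z_k|^2 + delta/2 |x - y_k|^2. *)
Definition step (t : nat) (z xt : vec) (i j : 'I_n) : vec * vec :=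
  let gt := gradf_d t xt in
  let y := tau_x t *: z + (1 - tau_x t) *: xt
           + tau_z t *: (delta t *: (xt - z) - gt) in
  let G := gradi_d t i y - gradi_d t i xt + gt in
  let z' := (alpha t + delta t)^-1 *: (alpha t *: z + delta t *: y - G) in
  (z', if nat_of_ord j == 0%N then y else xt).

Record outcome := Outcome {
  out_term : option nat;  (* Some t : terminated (gradient test) in outer iteration t *)
  out_last : nat;         (* last outer iteration that was started *)
  out_cost : nat          (* number of component-gradient evaluations *)
}.

(* Simulation of the outer iterations 0..ell, driven by the list of random
   draws.  Oracle cost: n for the full gradient at x~_0 at the start of each
   outer loop; per inner iteration 2 (for the two component gradients in G)
   plus n whenever x~ is updated (full gradient at the new snapshot). *)
Fixpoint sim (ell : nat) (ds : seq ('I_n * 'I_n)) (t k : nat) (z xt : vec)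
    (cost : nat) : outcome :=
  match ds with
  | [::] => Outcome None t cost
  | (i, j) :: ds' =>
      let zx := step t z xt i j in
      let cost' := (cost + 2 + (if nat_of_ord j == 0%N then n else 0))%N in
      if enorm (gradf xt) <= eps then Outcome (Some t) t cost'
      else if brk t k then
        (if (t < ell)%N then sim ell ds' t.+1 0 x0 x0 (cost' + n)%N
         else Outcome None t cost')
      else sim ell ds' t k.+1 zx.1 zx.2 cost'
  end.

Definition Ndraws (ell : nat) : nat := \sum_(t < ell.+1) (Kt t).+1.

(* sample space: i.i.d. uniform draws (i_k, j_k) in 'I_n * 'I_n *)
Definition Omega (ell : nat) := {ffun 'I_(Ndraws ell) -> 'I_n * 'I_n}.

Definition run (ell : nat) (w : Omega ell) : outcome :=
  sim ell (map w (enum 'I_(Ndraws ell))) 0 0 x0 x0 n.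

Definition Prob (ell : nat) (E : outcome -> bool) : R :=
  (\sum_(w : Omega ell) (E (run w))%:R) / #|{: Omega ell}|%:R.

Definition Expect (ell : nat) (X : outcome -> R) : R :=
  (\sum_(w : Omega ell) X (run w)) / #|{: Omega ell}|%:R.

End Algorithm.

(* Main.v *)
(** Write [s = alpha + delta], let [c] minimize [f + delta/2 |x - x0|^2], and let
    [h] be the Bregman divergence of [f] at [c]. Recentred at [c], the iteration
    reads [(s + L) (y - c) = alpha (z - c) + L (x~ - c) - grad h x~] and
    [s (z' - c) = alpha (z - c) - H], with [H] the variance-reduced estimator of
    [grad h y]. Cocoercivity of each component bounds the second moment of [H],
    and the equation defining [alpha] is exactly what makes the potential
    [2 (s + L) n h x~ + s^2 |z - c|^2] contract in expectation by the factor
    [(alpha / s)^2]. The stopping rule [sqrt C_IDC / delta <= (s / alpha)^K] then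
    gives [E |grad h x~_K|^2 <= delta^2 R0^2]. As [grad f = grad h + delta (x0 - c)]
    and [|x0 - c| <= R0], the mean of [|grad f x~_K|] is at most [2 delta R0], and
    Markov's inequality gives (i). For (ii), [s / delta = O(n + sqrt (n L / delta))]
    bounds the length of each inner loop, and the square roots sum geometrically
    over the outer loops. *)

Require Import Defs.
From mathcomp Require Import all_boot all_order all_algebra.
From mathcomp Require Import all_classical all_reals all_analysis.
From mathcomp Require Import zify ring lra.
Import Order.TTheory GRing.Theory Num.Theory.
Import numFieldNormedType.Exports.
Local Open Scope ring_scope.

(** * Euclidean geometry and smooth convex functions *)

Section Euclidean.
Context {R : realType} {d : nat}.
Implicit Types (u v w : 'rV[R]_d) (a : R).

Lemma dotvC u v : dotv u v = dotv v u.
Proof. by apply: eq_bigr => j _; rewrite mulrC. Qed.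

Lemma dotvDl u v w : dotv (u + v) w = dotv u w + dotv v w.
Proof. by rewrite -big_split; apply: eq_bigr => j _; rewrite mxE mulrDl. Qed.

Lemma dotvZl a u v : dotv (a *: u) v = a * dotv u v.
Proof. by rewrite mulr_sumr; apply: eq_bigr => j _; rewrite mxE mulrA. Qed.

Lemma dotvNl u v : dotv (- u) v = - dotv u v.
Proof. by rewrite -scaleN1r dotvZl mulN1r. Qed.

Lemma dotvDr u v w : dotv u (v + w) = dotv u v + dotv u w.
Proof. by rewrite dotvC dotvDl !(dotvC u). Qed.

Lemma dotvZr a u v : dotv u (a *: v) = a * dotv u v.
Proof. by rewrite dotvC dotvZl dotvC. Qed.

Lemma dotvNr u v : dotv u (- v) = - dotv u v.
Proof. by rewrite dotvC dotvNl dotvC. Qed.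

Definition dotvE := (dotvDl, dotvDr, dotvZl, dotvZr, dotvNl, dotvNr).

Lemma dotv0l v : dotv 0 v = 0.
Proof. by rewrite -(scale0r v) dotvZl mul0r. Qed.

Lemma dotv_suml (I : Type) (r : seq I) (F : I -> 'rV[R]_d) v :
  dotv (\sum_(i <- r) F i) v = \sum_(i <- r) dotv (F i) v.
Proof.
by elim/big_ind2: _ => [|x a y b <- <-|//]; rewrite ?dotv0l ?dotvDl.
Qed.

Lemma dotv_ge0 u : 0 <= dotv u u.
Proof. by apply: sumr_ge0 => j _; rewrite -expr2 sqr_ge0. Qed.

Lemma dotv_eq0 u : dotv u u = 0 -> u = 0.
Proof.
move=> u0; apply/rowP => j; rewrite mxE; apply/eqP; rewrite -sqrf_eq0 expr2.
move: u0 => /eqP; rewrite psumr_eq0 => [/allP/(_ j)|k _]; last exact: sqr_ge0.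
by rewrite mem_index_enum => /(_ isT).
Qed.

Lemma enorm_ge0 u : 0 <= enorm u. Proof. exact: sqrtr_ge0. Qed.

Lemma sqr_enorm u : enorm u ^+ 2 = dotv u u.
Proof. by rewrite sqr_sqrtr ?dotv_ge0. Qed.

Lemma enorm_leP u a : 0 <= a -> (enorm u <= a) = (dotv u u <= a ^+ 2).
Proof. by move=> a0; rewrite -sqr_enorm ler_pXn2r ?nnegrE ?enorm_ge0. Qed.

Lemma dotv_CauchySchwarz u v : dotv u v <= enorm u * enorm v.
Proof.
have [->|v0] := eqVneq v 0.
  by rewrite dotvC dotv0l mulr_ge0 ?enorm_ge0.
have vv : 0 < dotv v v.
  by rewrite lt_def dotv_ge0 andbT; apply: contraNneq v0 => /dotv_eq0 ->.
apply: le_trans (ler_norm _) _.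
rewrite -(@ler_pXn2r _ 2) ?nnegrE ?mulr_ge0 ?enorm_ge0//.
rewrite exprMn !sqr_enorm real_normK ?num_real//.
(* The square norm of this vector is [dotv v v] times the Gram determinant of [u] and [v]. *)
have := dotv_ge0 (dotv v v *: u - dotv u v *: v).
rewrite !dotvE (dotvC v u) => H.
have : 0 <= dotv v v * (dotv u u * dotv v v - dotv u v ^+ 2) by nra.
by rewrite pmulr_rge0// subr_ge0.
Qed.

Lemma enormD u v : enorm (u + v) <= enorm u + enorm v.
Proof.
rewrite enorm_leP ?addr_ge0 ?enorm_ge0// !dotvE (dotvC v u).
have := dotv_CauchySchwarz u v; have := sqr_enorm u; have := sqr_enorm v.
nra.
Qed.

Lemma enormZ a u : 0 <= a -> enorm (a *: u) = a * enorm u.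
Proof.
move=> a0; rewrite /enorm !dotvE mulrA -expr2 sqrtrM ?sqr_ge0// sqrtr_sqr.
by rewrite ger0_norm.
Qed.

Lemma continuous_dotv (c : 'rV[R]_d) :
  continuous (fun u => dotv (u - c) (u - c) : R).
Proof.
apply: continuous_big => [|j _ u]; first exact: add_continuous.
have cj : continuous (fun u' : 'rV[R]_d => (u' - c) ord0 j).
  have -> : (fun u' : 'rV[R]_d => (u' - c) ord0 j) = (fun u' => u' ord0 j - c ord0 j).
    by apply/funext => u'; rewrite !mxE.
  by move=> z; exact: (cvgB (@coord_continuous R 1 d ord0 j z) (cvg_cst _)).
exact: (cvgM (cj u) (cj u)).
Qed.

Lemma sqr_coord_le_dotv u j : u ord0 j ^+ 2 <= dotv u u.
Proof.
rewrite /dotv (bigD1 j)//= -expr2 lerDl.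
by apply: sumr_ge0 => k _; rewrite -expr2 sqr_ge0.
Qed.

End Euclidean.

Section SmoothConvex.
Context {R : realType} {d : nat}.
Variables (L : R) (h : 'rV[R]_d -> R) (gh : 'rV[R]_d -> 'rV[R]_d).
Hypotheses (L0 : 0 < L) (hsmooth : L_smooth L h gh).
Implicit Types x y u v w : 'rV[R]_d.

(** On a line the Fréchet gradient becomes a one-variable derivative, to which the mean value
    theorem applies. *)
Lemma is_derive_line x v (t : R) :
  is_derive t 1 (fun s => h (x + s *: v)) (dotv (gh (x + t *: v)) v).
Proof.
have [dh dhE] := hsmooth.1 (x + t *: v).
have lineE : (fun k : R => k^-1 *: (((fun s => h (x + s *: v)) \o shift t) (k *: 1)
    - h (x + t *: v))) =
  (fun k : R => k^-1 *: ((h \o shift (x + t *: v)) (k *: v) - h (x + t *: v))).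
  apply/funext => k /=; congr (_ *: (h _ - _)).
  by rewrite [k *: 1]mulr1 scalerDl addrCA.
have dv : derivable h (x + t *: v) v by exact: diff_derivable.
split; first by rewrite /derivable lineE.
by rewrite /derive lineE -dhE -deriveE.
Qed.

Lemma continuous_smooth : continuous h.
Proof. by move=> x; apply: differentiable_continuous; have [] := hsmooth.1 x. Qed.

Lemma gradient_line_le x v (t : R) : 0 <= t ->
  `|dotv (gh (x + t *: v) - gh x) v| <= L * t * dotv v v.
Proof.
move=> t0.
have E : enorm (gh (x + t *: v) - gh x) * enorm v <= L * t * dotv v v.
  rewrite -sqr_enorm expr2 mulrA ler_wpM2r ?enorm_ge0// -mulrA -enormZ//.
  by apply: le_trans (hsmooth.2 _ _) _; rewrite addrAC subrr add0r.
have CS := @dotv_CauchySchwarz R d.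
rewrite ler_norml (le_trans (CS _ _) E) andbT lerNl -dotvNr.
by apply: le_trans (CS _ _) _; move: E; rewrite /enorm (dotvNl v) dotvNr opprK.
Qed.

(** The subtracted quadratic in [th] has a derivative that absorbs the Lipschitz bound at every [t],
    so [th'] is nonpositive and the mean value theorem yields the sharp constant [L / 2] without
    integration. *)
Lemma smooth_upper_bound x v :
  h (x + v) <= h x + dotv (gh x) v + L / 2 * dotv v v.
Proof.
pose th (t : R) := h (x + t *: v) - (t * dotv (gh x) v + L / 2 * dotv v v * t ^+ 2).
pose th' (t : R) := dotv (gh (x + t *: v)) v - (dotv (gh x) v + L * dotv v v * t).
have dth (t : R) : is_derive t 1 th (th' t).
  have := is_derive_line x v t => ?.
  rewrite /th /th'; apply: is_derive_eq.
  by rewrite /GRing.scale/=; field.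
have cth := @derivable_within_continuous _ _ th `[0, 1]
  (fun t _ => @ex_derive _ _ _ _ _ _ _ (dth t)).
have [t /[!in_itv]/= /andP[t0 _]] := MVT_segment ler01 (fun t _ => dth t) cth.
rewrite /th /th' !scale1r !scale0r addr0.
have := @gradient_line_le x v t t0; rewrite ler_norml !dotvE => /andP[_].
nra.
Qed.

(* The constant [L] is not sharp: any quadratic error suffices to derive the
   tangent inequality from convexity. *)
Lemma smooth_lower_bound x v :
  h x + dotv (gh x) v - L * dotv v v <= h (x + v).
Proof.
have dth := is_derive_line x v.
have cth := @derivable_within_continuous _ _ _ `[0, 1]
  (fun t _ => @ex_derive _ _ _ _ _ _ _ (dth t)).
have [t /[!in_itv]/= /andP[t0 t1]] := MVT_segment ler01 (fun t _ => dth t) cth.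
rewrite /= !scale1r !scale0r addr0.
have := @gradient_line_le x v t t0; rewrite ler_norml !dotvE => /andP[+ _].
have : L * t * dotv v v <= L * dotv v v.
  by rewrite ler_wpM2r ?dotv_ge0// ger_pMr.
lra.
Qed.

Hypothesis hconv : convex_fun h.

(** Convexity on the segment and the quadratic lower bound at [x + t (y - x)] leave an error of
    order [t], which vanishes as [t] tends to 0. *)
Lemma convex_tangent_le x y : h x + dotv (gh x) (y - x) <= h y.
Proof.
have H (t : R) : 0 < t <= 1 ->
    dotv (gh x) (y - x) - h y + h x <= t * (L * dotv (y - x) (y - x)).
  move=> /andP[t0 t1].
  have := @hconv y x t; rewrite (ltW t0) t1 => /(_ isT).
  have -> : t *: y + (1 - t) *: x = x + t *: (y - x).
    by rewrite scalerBr scalerBl scale1r; rewrite addrC addrAC addrA.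
  have := smooth_lower_bound x (t *: (y - x)); rewrite !(dotvZl, dotvZr) => A B.
  rewrite -(ler_pM2l t0); nra.
set Q := dotv (gh x) (y - x) in H *; set P := L * _ in H.
rewrite leNgt; apply/negP => E.
have P0 : 0 <= P by exact: mulr_ge0 (ltW L0) (dotv_ge0 _).
have e0 : 0 < Q - h y + h x by lra.
(* For a positive excess, this [t] makes [t * P] at most half of it, against [H]; the [+ 1] covers
   [P = 0]. *)
pose t := Num.min 1 ((Q - h y + h x) / (P + 1) / 2).
have t0 : 0 < t by rewrite lt_min ltr01 !divr_gt0//; lra.
have := H t; rewrite t0 ge_min lexx => /(_ isT).
have : t * (P + 1) <= (Q - h y + h x) / 2.
  rewrite -ler_pdivlMr; last lra.
  by rewrite mulrAC ge_min lexx orbT.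
nra.
Qed.

(* Compare the tangent at [y], minimal there, with the gradient step from [x]
   for the function [h - <gh y, .>]. *)
Lemma cocoercive_bregman x y :
  dotv (gh x - gh y) (gh x - gh y) <= 2 * L * (h x - h y - dotv (gh y) (x - y)).
Proof.
set w := gh x - gh y.
have E : dotv (gh x) w = dotv w w + dotv (gh y) w.
  by rewrite -dotvDl /w subrK.
clearbody w.
have := convex_tangent_le y (x - L^-1 *: w).
have := smooth_upper_bound x (- L^-1 *: w); rewrite scaleNr.
rewrite !dotvE E; set D := dotv w w => A B.
have F : D / (2 * L) <= h x - h y - (dotv (gh y) x - dotv (gh y) y).
  have -> : D / (2 * L) = L^-1 * D - L / 2 * (L^-1 * (L^-1 * D)).
    by field; rewrite gt_eqF.
  lra.
have L2 : 0 < 2 * L by rewrite mulr_gt0.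
by move: F; rewrite ler_pdivrMr//; lra.
Qed.

End SmoothConvex.

(** * Existence and optimality condition of the regularized minimizer *)

Section RegularizedMinimizer.
Context {R : realType} {d n : nat}.
Variables (L : R) (f : 'I_n -> 'rV[R]_d -> R) (g : 'I_n -> 'rV[R]_d -> 'rV[R]_d).
Hypotheses (L0 : 0 < L) (n0 : (0 < n)%N).
Hypothesis fsmooth : forall i, L_smooth L (f i) (g i).
Implicit Types x y z c v : 'rV[R]_d.

Let nR0 : (n%:R : R) != 0. Proof. by rewrite pnatr_eq0 -lt0n. Qed.

Let mean_cst (a : R) : n%:R^-1 * \sum_(i < n) a = a.
Proof. by rewrite sumr_const card_ord -[a *+ n]mulr_natl mulKf. Qed.

Lemma dotv_gradf x v :
  dotv (gradf g x) v = n%:R^-1 * \sum_(i < n) dotv (g i x) v.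
Proof. by rewrite /gradf dotvZl dotv_suml. Qed.

Lemma mean_upper_bound x v :
  n%:R^-1 * \sum_(i < n) f i (x + v) <=
  n%:R^-1 * \sum_(i < n) f i x + dotv (gradf g x) v + L / 2 * dotv v v.
Proof.
rewrite dotv_gradf -(mean_cst (L / 2 * _)) -!mulrDr -!big_split/=.
rewrite ler_wpM2l ?invr_ge0 ?ler0n//; apply: ler_sum => i _.
exact: smooth_upper_bound.
Qed.

(** A gradient step of length [1 / (L + del)] lowers the regularized function by at least
    [|v|^2 / (2 (L + del))], with [v] its gradient at [c]; minimality forces [v = 0]. *)
Lemma gradf_regularized_min (del : R) x0 c : 0 <= del ->
  (forall x, n%:R^-1 * \sum_(i < n) f i c + del / 2 * dotv (c - x0) (c - x0)
     <= n%:R^-1 * \sum_(i < n) f i x + del / 2 * dotv (x - x0) (x - x0)) ->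
  gradf g c = del *: (x0 - c).
Proof.
move=> del0 cmin; pose v := gradf g c + del *: (c - x0).
suff /dotv_eq0 v0 : dotv v v = 0.
  by apply/eqP; rewrite -subr_eq0 -scalerN opprB; apply/eqP.
have E : dotv (gradf g c) v = dotv v v - del * dotv (c - x0) v.
  by rewrite -dotvZl -dotvNl -dotvDl /v addrK.
clearbody v.
have := cmin (c + - (L + del)^-1 *: v).
have := mean_upper_bound c (- (L + del)^-1 *: v).
rewrite -[c + _ - x0]addrAC.
have -> : dotv (c - x0 + - (L + del)^-1 *: v) (c - x0 + - (L + del)^-1 *: v) =
  dotv (c - x0) (c - x0) - 2 * (L + del)^-1 * dotv (c - x0) v
   + (L + del)^-1 ^+ 2 * dotv v v.
  by rewrite !(dotvDl (c - x0), dotvDr _ (c - x0)) !(dotvZl, dotvZr) (dotvC v); ring.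
rewrite ![dotv (_ *: v) _]dotvZl !dotvZr E.
set M := L + del; set D := dotv v v => A B.
have M0 : 0 < M by rewrite ltr_wpDr.
have D0 : 0 <= D := dotv_ge0 v.
have : 0 <= - M^-1 * D + M / 2 * (M^-1 * (M^-1 * D)).
  move: A B; move: M^-1 => Mi; rewrite /M; lra.
have -> : - M^-1 * D + M / 2 * (M^-1 * (M^-1 * D)) = - (D / (2 * M)).
  by field; rewrite gt_eqF.
rewrite oppr_ge0 => H; apply/eqP; rewrite eq_le D0 andbT.
by move: H; rewrite pmulr_lle0// invr_gt0 mulr_gt0.
Qed.

(** Since [F] is bounded below by [F xs], the regularizer makes points far from [x0] worse than [x0]
    itself, so a minimizer over a compact box is global. *)
Lemma exists_regularized_min (del : R) x0 xs : 0 < del ->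
  (forall x, n%:R^-1 * \sum_(i < n) f i xs <= n%:R^-1 * \sum_(i < n) f i x) ->
  exists c, gradf g c = del *: (x0 - c).
Proof.
move=> del0 xsmin.
pose F x := n%:R^-1 * \sum_(i < n) f i x.
pose G x := F x + del / 2 * dotv (x - x0) (x - x0).
(* At distance [rho] the regularizer equals [F x0 - F xs]. *)
pose rho := Num.sqrt (2 / del * (F x0 - F xs)).
pose I j := `[x0 ord0 j - rho, x0 ord0 j + rho]%classic.
pose A := [set x : 'rV[R]_d | forall j, I j (x ord0 j)]%classic.
have Ac : compact A.
  by apply: (@rV_compact _ _ I) => j; exact: segment_compact.
have rho0 : 0 <= rho by exact: sqrtr_ge0.
have x0A : A x0 by move=> j; rewrite /I/= in_itv/= gerBl lerDl rho0.
have Gc : continuous G.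
  have Fc : continuous F.
    have Sc : continuous (fun x => \sum_(i < n) f i x).
      apply: continuous_big => [|i _]; first exact: add_continuous.
      exact: continuous_smooth (fsmooth i).
    by move=> x; exact: (cvgM (cvg_cst _) (Sc x)).
  move=> x; exact: (cvgD (Fc x) (cvgM (cvg_cst _) (@continuous_dotv R d x0 x))).
have [c /set_mem cA cmin] := EVT_min_rV (ex_intro _ x0 x0A) Ac (continuous_subspaceT Gc).
exists c; apply: gradf_regularized_min (ltW del0) _ => x.
have [xA|xA] := pselect (A x); first by apply: cmin; exact: mem_set.
apply: le_trans (cmin _ (mem_set x0A)) _; rewrite /G subrr dotv0l mulr0 addr0.
have [j /negP xj] : exists j, ~ (x ord0 j \in `[x0 ord0 j - rho, x0 ord0 j + rho]).
  by apply/existsNP => H; apply: xA => j; exact: H.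
have rx : rho ^+ 2 <= dotv (x - x0) (x - x0).
  apply: le_trans (sqr_coord_le_dotv _ j); rewrite !mxE -(real_normK (num_real (_ - _))).
  rewrite ler_pXn2r ?nnegrE// leNgt; apply: contra xj.
  by rewrite ltr_norml in_itv/= => /andP[ge le]; apply/andP; split; lra.
rewrite -/(F x0) -/(F x).
have := xsmin x; rewrite -/(F xs) -/(F x) => Fx.
have := xsmin x0; rewrite -/(F xs) -/(F x0) => Fx0.
move: rx; rewrite sqr_sqrtr; last by rewrite mulr_ge0 ?subr_ge0// divr_ge0// ltW.
rewrite mulrAC ler_pdivrMr//; lra.
Qed.

End RegularizedMinimizer.
(** * Step-size parameters *)

Section StepSize.
Context {R : realType}.
Implicit Types L dl a : R.

(* With [s = a + dl], the equation [(1 - p s / (s + L)) (s / a)^2 = 1] reads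
   [n (s + L) (s^2 - a^2) = s^3]. *)
Lemma alpha_eqE n L dl a : (0 < n)%N -> 0 < L -> 0 < dl -> 0 < a ->
  alpha_eq n L dl a <->
  n%:R * (a + dl + L) * (dl * (2 * (a + dl) - dl)) = (a + dl) ^+ 3.
Proof.
move=> n0 L0 dl0 a0; rewrite /alpha_eq /pp.
have N0 : n%:R != 0 :> R by rewrite pnatr_eq0 -lt0n.
have aN : a != 0 by rewrite gt_eqF.
have sN : a + L + dl != 0 by rewrite gt_eqF// !addr_gt0.
have D0 : n%:R * (a + L + dl) * a ^+ 2 != 0 by rewrite !mulf_neq0// expf_neq0.
have E : (1 - n%:R^-1 * (a + dl) / (a + L + dl)) * (1 + dl / a) ^+ 2 - 1 =
  (n%:R * (a + dl + L) * (dl * (2 * (a + dl) - dl)) - (a + dl) ^+ 3)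
   / (n%:R * (a + L + dl) * a ^+ 2).
  by field; rewrite N0 aN sN.
split=> H; apply/eqP; rewrite -subr_eq0.
  move/eqP: H; rewrite -subr_eq0 E mulf_eq0 invr_eq0 (negPf D0) orbF => /eqP ->.
  by [].
by move/eqP: H; rewrite -subr_eq0 E => /eqP ->; rewrite mul0r.
Qed.

(** Intermediate value theorem for the cubic [P]; its strict negativity at 0 excludes the root 0. *)
Lemma alpha_eq_solvable n L dl : (0 < n)%N -> 0 < L -> 0 < dl ->
  exists a, 0 < a /\ alpha_eq n L dl a.
Proof.
move=> n0 L0 dl0; have N1 : 1 <= n%:R :> R by rewrite ler1n.
pose s : {poly R} := 'X + dl%:P.
pose P := s ^+ 3 - (n%:R * dl)%:P * (s + L%:P) * (2%:P * s - dl%:P).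
have PE a : P.[a] = (a + dl) ^+ 3
    - n%:R * dl * (a + dl + L) * (2 * (a + dl) - dl).
  by rewrite /P /s !hornerE.
(* At this right end point [a + dl = 2 n dl + L], and [P] expands into nonnegative terms. *)
have b0 : 0 <= 2 * n%:R * dl + L - dl by nra.
have P0 : P.[0] < 0.
  rewrite PE.
  have -> : (0 + dl) ^+ 3 - n%:R * dl * (0 + dl + L) * (2 * (0 + dl) - dl) =
    - (dl ^+ 3 * (n%:R - 1) + n%:R * dl * dl * L) by ring.
  rewrite oppr_lt0 ltr_wpDl ?mulr_ge0 ?subr_ge0 ?exprn_ge0 ?(ltW dl0)//.
  by rewrite !mulr_gt0// ltr0n.
have Pb : 0 <= P.[2 * n%:R * dl + L - dl].
  rewrite PE.
  set N := n%:R in N1 *.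
  have -> : (2 * N * dl + L - dl + dl) ^+ 3 - N * dl * (2 * N * dl + L - dl + dl + L)
      * (2 * (2 * N * dl + L - dl + dl) - dl) =
      (2 * N * dl + L) * L ^+ 2 + N * dl * dl * (2 * N * dl + 2 * L) by ring.
  have NN : 0 <= N by lra.
  by rewrite addr_ge0 ?mulr_ge0 ?addr_ge0 ?mulr_ge0 ?sqr_ge0// ltW.
have [a /andP[a0 _] /rootP Pa] := @poly_ivt R P _ _ b0 (introT andP (conj (ltW P0) Pb)).
have a_gt0 : 0 < a.
  by rewrite lt_def a0 andbT; apply: contraTneq P0 => aE; rewrite -{1}aE Pa ltxx.
exists a; split=> //; apply/alpha_eqE => //.
by apply/eqP; rewrite -subr_eq0 -oppr_eq0 -Pa PE; apply/eqP; ring.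
Qed.

Lemma delta_gt0 L beta t : 0 < L -> 1 < beta -> 0 < delta L beta t.
Proof. by move=> L0 b1; rewrite divr_gt0// exprn_gt0// (lt_trans ltr01). Qed.

Lemma delta_le L beta t : 0 < L -> 1 < beta -> delta L beta t <= L.
Proof.
move=> L0 b1; rewrite ler_pdivrMr ?exprn_gt0 ?(lt_trans ltr01)//.
by rewrite ler_pMr// exprn_ege1// ltW.
Qed.

Section Alpha.
Variables (n : nat) (L beta : R) (t : nat).
Hypotheses (n0 : (0 < n)%N) (L0 : 0 < L) (beta1 : 1 < beta).
Let dl := delta L beta t.
Let a := alpha n L beta t.
Let s := a + dl.

Let dl0 : 0 < dl. Proof. exact: delta_gt0. Qed.

(** A root exists, so the default value 1 of [xget] is never what defines [alpha]. *)
Lemma alpha_spec : 0 < a /\ alpha_eq n L dl a.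
Proof. exact: xgetPex (alpha_eq_solvable n L dl n0 L0 dl0). Qed.

Lemma alpha_gt0 : 0 < a. Proof. exact: alpha_spec.1. Qed.

Lemma alpha_cubic : n%:R * (s + L) * (dl * (2 * s - dl)) = s ^+ 3.
Proof. by apply/alpha_eqE; [| | |exact: alpha_gt0|exact: alpha_spec.2]. Qed.

Let s0 : 0 < s. Proof. by rewrite addr_gt0 ?alpha_gt0. Qed.
Let N0 : 0 < n%:R :> R. Proof. by rewrite ltr0n. Qed.

(** The cubic reads [n (s + L) a^2 = (n L + (n - 1) s) s^2], which eliminates [a]. This form matches
    the initial potential. *)
Lemma C_IDCE : C_IDC n L beta t = L ^+ 2 + L * s ^+ 2 / (n%:R * (s + L)).
Proof.
rewrite /C_IDC /pp -/a -/dl -/s.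
have a0 := alpha_gt0.
have n1 : 1 <= n%:R :> R by rewrite ler1n.
have NLs : 0 < n%:R * L + (n%:R - 1) * s.
  by rewrite ltr_pwDl ?mulr_gt0// mulr_ge0 ?subr_ge0// ltW.
have sL : 0 < s + L by rewrite addr_gt0.
have E : n%:R * (s + L) * a ^+ 2 = (n%:R * L + (n%:R - 1) * s) * s ^+ 2.
  have := alpha_cubic; rewrite -[a](addrK dl) -/s => E.
  have -> : n%:R * (s + L) * (s - dl) ^+ 2 =
    n%:R * (s + L) * s ^+ 2 - n%:R * (s + L) * (dl * (2 * s - dl)) by ring.
  by rewrite E; ring.
congr (_ + _); apply/eqP.
have -> : L + (1 - n%:R^-1) * s = (n%:R * L + (n%:R - 1) * s) / n%:R.
  by field; rewrite gt_eqF.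
rewrite eqr_div; [|by rewrite gt_eqF// divr_gt0|by rewrite gt_eqF// mulr_gt0].
apply/eqP; have -> : L * a ^+ 2 / n%:R * (n%:R * (s + L)) =
  L * (n%:R * (s + L) * a ^+ 2) / n%:R by field; rewrite gt_eqF.
by rewrite E; ring.
Qed.

(** By the cubic, [s^2 / (n (s + L)) = dl (2 s - dl) / s], which is at most [2 dl <= 2 L]. *)
Lemma C_IDC_le : C_IDC n L beta t <= 3 * L ^+ 2.
Proof.
rewrite C_IDCE.
have sL : 0 < n%:R * (s + L) by rewrite mulr_gt0// addr_gt0.
suff : L * s ^+ 2 / (n%:R * (s + L)) <= 2 * L ^+ 2 by lra.
rewrite ler_pdivrMr// -(ler_pM2r s0).
have -> : L * s ^+ 2 * s = L * s ^+ 3 by ring.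
rewrite -alpha_cubic.
have -> : L * (n%:R * (s + L) * (dl * (2 * s - dl))) =
  n%:R * (s + L) * (L * (dl * (2 * s - dl))) by ring.
have -> : 2 * L ^+ 2 * (n%:R * (s + L)) * s = n%:R * (s + L) * (L * (L * 2 * s)) by ring.
rewrite ler_pM2l// ler_pM2l//.
have : dl <= L by exact: delta_le.
have := dl0; have := s0; nra.
Qed.

(** Bounding [2 s - dl] by [2 s] in the cubic gives [u^2 <= 2 n u + 2 n L / dl] for [u = s / dl], a
    quadratic inequality to be solved for [u]. *)
Lemma alpha_ratio_le : s / dl <= 2 * n%:R + 2 * Num.sqrt (n%:R * (L / dl)).
Proof.
set r := Num.sqrt _.
have rr : r ^+ 2 = n%:R * (L / dl) by rewrite sqr_sqrtr// ltW// mulr_gt0// divr_gt0.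
have r0 : 0 <= r by exact: sqrtr_ge0.
have E : (s / dl) ^+ 2 <= 2 * n%:R * (s / dl) + 2 * (n%:R * (L / dl)).
  have -> : 2 * n%:R * (s / dl) + 2 * (n%:R * (L / dl)) = 2 * n%:R * (s + L) * dl / dl ^+ 2.
    by field; rewrite gt_eqF.
  rewrite expr_div_n ler_pM2r ?invr_gt0 ?exprn_gt0// -(ler_pM2r s0) -exprSr -alpha_cubic.
  have -> : 2 * n%:R * (s + L) * dl * s = n%:R * (s + L) * (dl * (2 * s)) by ring.
  rewrite !ler_wpM2l ?gerBl ?(ltW dl0)//.
  by rewrite ltW// mulr_gt0// addr_gt0.
rewrite -rr in E; rewrite leNgt; apply/negP => H.
have := N0; nra.
Qed.

End Alpha.
End StepSize.

(** * One-step contraction of the potential *)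

Section Contraction.
Context {R : realType} {d n : nat}.
Variables (L : R) (f : 'I_n -> 'rV[R]_d -> R) (g : 'I_n -> 'rV[R]_d -> 'rV[R]_d).
Hypotheses (L0 : 0 < L) (n0 : (0 < n)%N).
Hypothesis fsmooth : forall i, L_smooth L (f i) (g i).
Hypothesis fconv : forall i, convex_fun (f i).
Implicit Types x y z c v : 'rV[R]_d.
Let N : R := n%:R.

Let N0 : 0 < N. Proof. by rewrite ltr0n. Qed.

Definition mean_bregman c x : R :=
  N^-1 * \sum_(i < n) (f i x - f i c - dotv (g i c) (x - c)).

Lemma sum_gradE x : \sum_(i < n) g i x = N *: gradf g x.
Proof. by rewrite /gradf /pp scalerA mulfV ?scale1r// gt_eqF. Qed.

Lemma sum_dotv_grad x v : \sum_(i < n) dotv (g i x) v = N * dotv (gradf g x) v.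
Proof. by rewrite -dotv_suml sum_gradE dotvZl. Qed.

Lemma mean_bregman_le c x :
  mean_bregman c x <= L / 2 * dotv (x - c) (x - c).
Proof.
have := mean_upper_bound L f g n0 fsmooth c (x - c).
rewrite addrC subrK dotv_gradf /mean_bregman !sumrB -/N !mulrBr; lra.
Qed.

Lemma mean_bregman_le_dotv c y :
  mean_bregman c y <= dotv (gradf g y - gradf g c) (y - c).
Proof.
rewrite dotvDl dotvNl !dotv_gradf /mean_bregman -mulrBr ler_wpM2l ?invr_ge0 ?ler0n//.
rewrite -sumrB; apply: ler_sum => i _; rewrite lerD2r lerBlDl addrC -lerBlDl.
have := convex_tangent_le L (f i) (g i) L0 (fsmooth i) (fconv i) y c.
by rewrite -(opprB y c) dotvNr.
Qed.

(** Cocoercivity of each component, summed; this controls the noise of the variance-reduced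
    estimator. *)
Lemma sum_dotv_grad_le x y :
  \sum_(i < n) dotv (g i y - g i x) (g i y - g i x) <=
  2 * L * N * mean_bregman y x.
Proof.
rewrite /mean_bregman -(mulrA (2 * L)) mulVKf ?gt_eqF// mulr_sumr; apply: ler_sum => i _.
rewrite -(opprB (g i x)) dotvNl dotvNr opprK.
exact: cocoercive_bregman (fsmooth i) (fconv i) x y.
Qed.

(** Moves the base point of the noise bound from [y] to [c], the base point of the potential. *)
Lemma mean_bregman_three_point c x y :
  mean_bregman y x = mean_bregman c x - mean_bregman c y
    - dotv (gradf g y - gradf g c) (x - y).
Proof.
rewrite dotvDl dotvNl !dotv_gradf /mean_bregman -!mulrBr -!sumrB.
by congr (_ * _); apply: eq_bigr => i _; rewrite !dotvDr !dotvNr; ring.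
Qed.

(** The vectors [g i x - g i c] have mean [m] and nonnegative variance, so [|m|^2] is at most their
    mean square, which cocoercivity bounds. *)
Lemma dotv_gradfB_le c x :
  dotv (gradf g x - gradf g c) (gradf g x - gradf g c) <= 2 * L * mean_bregman c x.
Proof.
pose m := gradf g x - gradf g c.
rewrite -(ler_pM2l N0) mulrC -[N * (2 * L * _)]mulrCA mulrA -/m.
apply: le_trans (sum_dotv_grad_le x c).
have : 0 <= \sum_(i < n) dotv (g i x - g i c - m) (g i x - g i c - m).
  by apply: sumr_ge0 => i _; exact: dotv_ge0.
have -> : \sum_(i < n) dotv (g i x - g i c - m) (g i x - g i c - m) =
    \sum_(i < n) dotv (g i c - g i x) (g i c - g i x)
    - 2 * (\sum_(i < n) dotv (g i x) m - \sum_(i < n) dotv (g i c) m)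
    + \sum_(i < n) dotv m m.
  clearbody m; rewrite -sumrB mulr_sumr -sumrB -big_split/=; apply: eq_bigr => i _.
  rewrite !dotvDl !dotvDr !dotvNl !dotvNr (dotvC m (g i x)) (dotvC m (g i c)).
  by rewrite (dotvC (g i c) (g i x)); ring.
rewrite !sum_dotv_grad -mulrBr -dotvNl -dotvDl -/m sumr_const card_ord.
rewrite -[dotv m m *+ n]mulr_natl -/N; lra.
Qed.

Section Step.
Variables (beta : R) (t : nat) (x0 c : 'rV[R]_d).
Hypothesis beta1 : 1 < beta.
Let dl := delta L beta t.
Let a := alpha n L beta t.
Let s := a + dl.
Hypothesis gradf_c : gradf g c = dl *: (x0 - c).

Let dl0 : 0 < dl. Proof. exact: delta_gt0. Qed.
Let a0 : 0 < a. Proof. exact: alpha_gt0. Qed.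
Let s0 : 0 < s. Proof. by rewrite addr_gt0. Qed.
Let sL0 : 0 < s + L. Proof. by rewrite addr_gt0. Qed.

Definition potential (zx : 'rV[R]_d * 'rV[R]_d) : R :=
  2 * (s + L) * N * mean_bregman c zx.2 + s ^+ 2 * dotv (zx.1 - c) (zx.1 - c).

(** The regularized gradient vanishes at [c], so recentring there removes [x0]. *)
Lemma gradf_dE x : gradf_d g L beta x0 t x = gradf g x - gradf g c + dl *: (x - c).
Proof.
rewrite /gradf_d /gradi_d big_split/= scalerDr sumr_const card_ord.
rewrite -[X in _ + pp R n *: X]scaler_nat scalerA mulVf ?gt_eqF// scale1r.
rewrite gradf_c -addrA -scalerN -scalerDr; congr (_ + _ *: _).
by apply/rowP => j; rewrite !mxE; ring.
Qed.

Let y z x : 'rV[R]_d := tau_x n L beta t *: z + (1 - tau_x n L beta t) *: x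
  + tau_z n L beta t *: (dl *: (x - z) - gradf_d g L beta x0 t x).

(* [tau_z] is chosen so that [y] becomes this combination once the shifted
   gradient is recentred at the regularized minimizer [c]. *)
Lemma y_shift z x :
  (s + L) *: (y z x - c) = a *: (z - c) + L *: (x - c) - (gradf g x - gradf g c).
Proof.
rewrite /y gradf_dE; move: (gradf g x - _) => G.
have -> : tau_x n L beta t = s / (s + L).
  by rewrite /tau_x -/a -/dl addrAC.
have -> : tau_z n L beta t = (s + L)^-1.
  rewrite /tau_z /tau_x -/a -/dl.
  have := sL0; have := dl0; have := L0; rewrite /s [a + L + dl]addrAC.
  by move: (a) (dl) => a' dl' ? ? ?; field; rewrite !gt_eqF.
have := sL0; rewrite /s; move: (a) (dl) => a' dl' ?.
by apply/rowP => j; rewrite !mxE; field; rewrite gt_eqF.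
Qed.

(** The proximal term at [y] cancels the regularizer's share of the estimator, leaving gradients of
    the original components only. *)
Lemma step_z_shift z x i j :
  s *: ((step g L beta x0 t z x i j).1 - c) =
  a *: (z - c) - (g i (y z x) - g i x + (gradf g x - gradf g c)).
Proof.
rewrite /step/= /gradi_d -/a -/dl -/s -/(y z x) gradf_dE.
move: (gradf g x - _) (y z x) => G y'.
have := s0; rewrite /s; move: (a) (dl) => a' dl' ?.
by apply/rowP => k; rewrite !mxE; field; rewrite gt_eqF.
Qed.

(** With the noise bound rewritten by the three-point identity, the terms in [dotv gy (x - c)]
    cancel. What remains is [- 2 N s * dotv gy (y - c)], at most [- 2 N s] times the divergence at
    [y], which cancels the divergence at [y] altogether. *)
Lemma potential_step z x :
  \sum_(ij : 'I_n * 'I_n) potential (step g L beta x0 t z x ij.1 ij.2) <=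
  N ^+ 2 * ((a / s) ^+ 2 * potential (z, x)).
Proof.
(* Of the [n] values of the coin, only 0 moves the snapshot to [y]. *)
have Sx : \sum_(j < n) mean_bregman c (if nat_of_ord j == 0%N then y z x else x)
    = mean_bregman c (y z x) + (N - 1) * mean_bregman c x.
  move: n0 (y z x) (mean_bregman c); rewrite /N; clear; case: n => // m _ u mb.
  have -> : m.+1%:R - 1 = m%:R :> R by rewrite -natr1 addrK.
  by rewrite big_ord_recl/= sumr_const card_ord mulr_natl.
pose gx := gradf g x - gradf g c; pose gy := gradf g (y z x) - gradf g c.
pose W := a *: (z - c) - gx.
pose v i := g i (y z x) - g i x.
have Wv i j : s ^+ 2 * dotv ((step g L beta x0 t z x i j).1 - c)
    ((step g L beta x0 t z x i j).1 - c) = dotv (W - v i) (W - v i).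
  rewrite exprS expr1 -mulrA -dotvZr -dotvZl step_z_shift /W /v.
  by rewrite [- (_ + (gradf g x - _))]opprD addrA [_ - _ - (gradf g x - _)]addrAC.
have Si i : \sum_(j < n) potential (step g L beta x0 t z x i j) =
    2 * (s + L) * N * (mean_bregman c (y z x) + (N - 1) * mean_bregman c x)
    + N * dotv (W - v i) (W - v i).
  rewrite /potential big_split/= -mulr_sumr Sx; congr (_ + _).
  rewrite (eq_bigr _ (fun j _ => Wv i j)) sumr_const card_ord.
  by rewrite -[_ *+ n]mulr_natl.
have -> : \sum_(ij : 'I_n * 'I_n) potential (step g L beta x0 t z x ij.1 ij.2) =
   N * (2 * (s + L) * N * (mean_bregman c (y z x) + (N - 1) * mean_bregman c x)
       + (N * dotv W W - 2 * N * dotv (gy - gx) W + \sum_(i < n) dotv (v i) (v i))).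
  rewrite -(pair_bigA _ (fun i j => potential (step g L beta x0 t z x i j)))/=.
  rewrite (eq_bigr _ (fun i _ => Si i)).
  rewrite big_split/= sumr_const card_ord -[_ *+ n]mulr_natl -/N -mulr_sumr -mulrDr.
  congr (_ * (_ + _)).
  have -> : gy - gx = gradf g (y z x) - gradf g x.
    by rewrite /gx /gy opprB addrA subrK.
  rewrite -(mulrA 2) dotvDl dotvNl mulrBr -!sum_dotv_grad -sumrB.
  have -> : N * dotv W W = \sum_(i < n) dotv W W.
    by rewrite sumr_const card_ord -[_ *+ n]mulr_natl.
  rewrite mulr_sumr -sumrB -big_split/=; apply: eq_bigr => i _.
  rewrite -(dotvNl (g i x)) -dotvDl -/(v i); move: (v i) (W) => vi W'.
  by rewrite !dotvE (dotvC W'); ring.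
have V := sum_dotv_grad_le x (y z x).
have hyx := mean_bregman_three_point c x (y z x).
have hy := mean_bregman_le_dotv c (y z x).
have gyW : dotv gy W = (s + L) * dotv gy (y z x - c) - L * dotv gy (x - c).
  have -> : W = (s + L) *: (y z x - c) - L *: (x - c).
    by rewrite y_shift /W -/gx addrAC addrK.
  by rewrite (dotvDr _ (_ *: _)) (dotvNr _ (_ *: _)) !dotvZr.
have gyxy : dotv gy (x - y z x) = dotv gy (x - c) - dotv gy (y z x - c).
  by rewrite -dotvNr -dotvDr opprB addrA subrK.
have WW : dotv W W + 2 * dotv gx W <= a ^+ 2 * dotv (z - c) (z - c).
  have -> : dotv W W + 2 * dotv gx W =
      a ^+ 2 * dotv (z - c) (z - c) - dotv gx gx.
    rewrite /W; move: (gx) (z - c) => G Z; rewrite !dotvE (dotvC Z G); ring.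
  by rewrite gerBl dotv_ge0.
have -> : N ^+ 2 * ((a / s) ^+ 2 * potential (z, x)) = N ^+ 2 *
    (2 * (N * (s + L) - s) * mean_bregman c x + a ^+ 2 * dotv (z - c) (z - c)).
  rewrite /potential/=; congr (_ * _).
  (* The equation of [alpha] enters here: scaling by [(a / s)^2] turns the weight [N (s + L)] into
     [N (s + L) - s]. *)
  have E : N * (s + L) * a ^+ 2 = (N * (s + L) - s) * s ^+ 2.
    have := alpha_cubic n L beta t n0 L0 beta1; rewrite -/dl -/a -/s -/N => E.
    have -> : a = s - dl by rewrite /s addrK.
    by rewrite mulrBl -exprS -E; move: (s) (dl) => s' dl'; ring.
  have -> : (a / s) ^+ 2 * (2 * (s + L) * N * mean_bregman c x
        + s ^+ 2 * dotv (z - c) (z - c)) =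
      2 * (N * (s + L) * a ^+ 2) / s ^+ 2 * mean_bregman c x
      + a ^+ 2 * dotv (z - c) (z - c).
    by have := s0; move: (s) (a) => s' a' ?; field; rewrite gt_eqF.
  by rewrite E; have := s0; move: (s) => s' ?; field; rewrite gt_eqF.
rewrite expr2 -(mulrA N N) ler_pM2l//.
move: V; rewrite hyx -/gy gyxy => V.
rewrite (dotvDl gy (- gx) W) dotvNl gyW.
have {}WW : N * (dotv W W + 2 * dotv gx W) <= N * (a ^+ 2 * dotv (z - c) (z - c)).
  by rewrite ler_pM2l.
have {}hy : N * s * mean_bregman c (y z x) <= N * s * dotv gy (y z x - c).
  by rewrite ler_pM2l// mulr_gt0.
lra.
Qed.

(** Smoothness bounds the divergence by [L / 2] times the squared distance; the two weights then add
    up to a multiple of [C_IDC]. *)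
Lemma potential_init :
  potential (x0, x0) <= N * (s + L) / L * C_IDC n L beta t * dotv (x0 - c) (x0 - c).
Proof.
rewrite C_IDCE// -/dl -/a -/s -/N /potential/=.
have -> : N * (s + L) / L * (L ^+ 2 + L * s ^+ 2 / (N * (s + L))) =
    N * (s + L) * L + s ^+ 2.
  have := s0; have := sL0; have := N0; have := L0; move: (s) => s' ? ? ? ?.
  by field; rewrite !gt_eqF.
rewrite [X in _ <= X]mulrDl lerD2r.
have : N * (s + L) * mean_bregman c x0 <=
    N * (s + L) * (L / 2 * dotv (x0 - c) (x0 - c)).
  by rewrite ler_pM2l ?mean_bregman_le// mulr_gt0.
lra.
Qed.

(** The prefactor is the one of [potential_init], so it drops out when the two are combined. *)
Lemma le_potential zx :
  N * (s + L) / L * dotv (gradf g zx.2 - gradf g c) (gradf g zx.2 - gradf g c)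
  <= potential zx.
Proof.
apply: (@le_trans _ _ (2 * (s + L) * N * mean_bregman c zx.2)).
  have -> : 2 * (s + L) * N * mean_bregman c zx.2 =
      N * (s + L) / L * (2 * L * mean_bregman c zx.2).
    by have := L0 => ?; field; rewrite gt_eqF.
  by rewrite ler_wpM2l ?dotv_gradfB_le// ltW// divr_gt0// mulr_gt0.
by rewrite lerDl mulr_ge0 ?sqr_ge0 ?dotv_ge0.
Qed.

End Step.

Lemma mean_bregman_ge0 c x : 0 <= mean_bregman c x.
Proof.
have L2 : 0 < 2 * L by rewrite mulr_gt0.
by rewrite -(pmulr_rge0 _ L2) (le_trans (dotv_ge0 _) (dotv_gradfB_le c x)).
Qed.

(** Monotonicity of the gradient between [c] and [xs] gives [0 <= dotv (x0 - c) (c - xs)]: the angle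
    at [c] is not acute. *)
Lemma dist_regularized_min (del : R) x0 c xs : 0 < del ->
  gradf g c = del *: (x0 - c) -> gradf g xs = 0 ->
  dotv (x0 - c) (x0 - c) <= dotv (x0 - xs) (x0 - xs).
Proof.
move=> del0 gc gxs.
have := le_trans (mean_bregman_ge0 xs c) (mean_bregman_le_dotv xs c).
rewrite gc gxs subr0 dotvZl pmulr_rge0// => H.
rewrite -[x0 - xs](subrKA c); move: (x0 - c) (c - xs) H => u v H.
have := dotv_ge0 v.
rewrite dotvDl !dotvDr (dotvC v u); lra.
Qed.

End Contraction.

(** * Random draws and the simulated run *)

Section UniformWords.
Context {R : realType} {T : finType}.
Implicit Types (F G : seq T -> R) (m : nat).

(** Expectation over [m] i.i.d. uniform letters, averaged one letter at a time to follow the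
    recursion of [sim] and [foldl]. *)
Fixpoint word_mean m F : R :=
  if m is m'.+1 then #|T|%:R^-1 * \sum_x word_mean m' (fun s => F (x :: s))
  else F [::].

Lemma word_mean_ffun m F :
  (\sum_(w : {ffun 'I_m -> T}) F (map w (enum 'I_m)))
    / #|{: {ffun 'I_m -> T}}|%:R = word_mean m F.
Proof.
rewrite card_ffun card_ord; elim: m F => [|m IH] F /=.
  have -> : enum 'I_0 = [::] by apply: size0nil; rewrite size_enum_ord.
  by rewrite /= sumr_const card_ffun card_ord expn0 divr1.
under [in RHS]eq_bigr do rewrite -IH.
rewrite -mulr_suml expnS natrM invfM mulrCA; congr (_ * (_ * _)).
rewrite pair_bigA/=.
(* Bijection that splits off the first draw. *)
pose glue (p : T * {ffun 'I_m -> T}) : {ffun 'I_m.+1 -> T} :=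
  [ffun i => if unlift ord0 i is Some j then p.2 j else p.1].
pose cut (w : {ffun 'I_m.+1 -> T}) := (w ord0, [ffun j => w (lift ord0 j)]).
have glueK : cancel glue cut.
  move=> [x w]; rewrite /cut ffunE unlift_none/=; congr pair.
  by apply/ffunP => j; rewrite !ffunE liftK.
have cutK : cancel cut glue.
  move=> w; apply/ffunP => i; rewrite ffunE /cut/=.
  by case: unliftP => [j|] ->; rewrite ?ffunE.
rewrite (reindex glue) /=; last by exists cut => ? _; [exact: glueK|exact: cutK].
apply: eq_bigr => -[x w] _; congr F.
rewrite enum_ordSl/= ffunE unlift_none -map_comp; congr (_ :: _).
by apply: eq_map => j; rewrite /= ffunE liftK.
Qed.

Lemma eq_word_mean m F G : F =1 G -> word_mean m F = word_mean m G.
Proof. by move=> /funext ->. Qed.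

Lemma word_mean_le m F G :
  (forall s, size s = m -> F s <= G s) -> word_mean m F <= word_mean m G.
Proof.
elim: m F G => [|m IH] F G FG /=; first exact: FG.
rewrite ler_wpM2l ?invr_ge0 ?ler0n//; apply: ler_sum => x _.
by apply: IH => s sm; apply: FG; rewrite /= sm.
Qed.

Lemma word_meanD m F G :
  word_mean m (fun s => F s + G s) = word_mean m F + word_mean m G.
Proof.
by elim: m F G => [//|m IH] F G /=; under eq_bigr do rewrite IH; rewrite big_split mulrDr.
Qed.

Lemma word_meanZ m (k : R) F : word_mean m (fun s => k * F s) = k * word_mean m F.
Proof.
by elim: m F => [//|m IH] F /=; under eq_bigr do rewrite IH; rewrite -mulr_sumr mulrCA.
Qed.

Hypothesis T0 : (0 < #|T|)%N.

Lemma word_mean_cst m (k : R) : word_mean m (fun=> k) = k.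
Proof.
elim: m => [//|m IH] /=; under eq_bigr do rewrite IH.
by rewrite sumr_const -[k *+ _]mulr_natl mulKf// pnatr_eq0 -lt0n.
Qed.

Lemma word_mean_sum m (h : T -> R) :
  word_mean m (fun s => \sum_(x <- s) h x) = m%:R * (#|T|%:R^-1 * \sum_x h x).
Proof.
elim: m => [|m IH] /=; first by rewrite big_nil mul0r.
under eq_bigr => x _.
  rewrite (eq_word_mean _ _ (fun s => h x + \sum_(x <- s) h x)); last first.
    by move=> s; rewrite big_cons.
  rewrite word_meanD word_mean_cst IH; over.
rewrite big_split/= sumr_const -[X in _ + X]mulr_natl mulrDr mulKf ?pnatr_eq0 -?lt0n//.
by rewrite -natr1 mulrDl mul1r addrC.
Qed.

End UniformWords.

(** * Success probability through the outer loops *)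

Section OuterLoops.
Context {R : realType} {d n : nat}.
Variables (L eps beta : R) (g : 'I_n -> 'rV[R]_d -> 'rV[R]_d) (x0 : 'rV[R]_d).
Hypotheses (L0 : 0 < L) (n0 : (0 < n)%N) (beta1 : 1 < beta).
Let draw : finType := ('I_n * 'I_n)%type.

Lemma card_draw : #|draw| = (n * n)%N.
Proof. by rewrite card_prod card_ord. Qed.

Lemma card_draw_gt0 : (0 < #|draw|)%N.
Proof. by rewrite card_draw muln_gt0 n0. Qed.

Lemma bernoulli_expr (u : R) k : 0 <= u -> 1 + k%:R * u <= (1 + u) ^+ k.
Proof.
move=> u0; elim: k => [|k IH]; first by rewrite mul0r addr0 expr0.
rewrite exprS -natr1; apply: le_trans (ler_wpM2l _ IH); last lra.
have : 0 <= k%:R * (u * u) by rewrite !mulr_ge0.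
lra.
Qed.

(** By Bernoulli's inequality the powers in the break test are unbounded, so a first breaking index
    exists and [xget] returns it. *)
Lemma Kt_spec t : brk n L beta t (Kt n L beta t) /\
  forall k, (k < Kt n L beta t)%N -> ~~ brk n L beta t k.
Proof.
apply: (@xgetPex _ 0%N [set k | brk n L beta t k /\
  forall k', (k' < k)%N -> ~~ brk n L beta t k']%classic).
have ex : exists k, brk n L beta t k.
  set u := delta L beta t / alpha n L beta t.
  have u0 : 0 < u by rewrite divr_gt0 ?delta_gt0 ?alpha_gt0.
  pose b := Num.sqrt (C_IDC n L beta t) / delta L beta t.
  have dl_ge0 := ltW (delta_gt0 L beta t L0 beta1).
  have b0 : 0 <= b / u by exact: divr_ge0 (divr_ge0 (sqrtr_ge0 _) dl_ge0) (ltW u0).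
  exists (Num.bound (b / u)); rewrite /brk -/u -/b.
  apply: le_trans (bernoulli_expr u _ (ltW u0)).
  have := archi_boundP b0; rewrite ltr_pdivrMr//; lra.
exists (ex_minn ex); case: ex_minnP => k bk kmin; split=> // k' kk'.
by apply/negP => /kmin; rewrite leqNgt kk'.
Qed.

Definition stepf t (zx : 'rV[R]_d * 'rV[R]_d) (ij : draw) : 'rV[R]_d * 'rV[R]_d :=
  step g L beta x0 t zx.1 zx.2 ij.1 ij.2.

(** Compares the run with the iteration that ignores the gradient test; passing the test earlier
    only helps. [sim] tests a snapshot only when a draw is left, hence [m.+1] draws to test the
    snapshot reached after [m] steps. *)
Lemma last_outer_success ell k m z xt cost : (k + m)%N = Kt n L beta ell ->
  word_mean m (fun s : seq draw =>
    (enorm (gradf g (foldl (stepf ell) (z, xt) s).2) <= eps)%R%:R : R) <=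
  word_mean m.+1 (fun s : seq draw =>
    (out_term (sim g L eps beta x0 ell s ell k z xt cost) == Some ell)%:R : R).
Proof.
have [_ nbrk] := Kt_spec ell.
elim: m k z xt cost => [|m IH] k z xt cost km.
  have [small|] := boolP (enorm (gradf g xt) <= eps); last first.
    move=> /negPf small; rewrite [X in X <= _]/= small.
    rewrite -[X in X <= _](word_mean_cst card_draw_gt0 1).
    by apply: word_mean_le => s _; rewrite ler0n.
  rewrite -[X in X <= _](word_mean_cst card_draw_gt0 1).
  apply: word_mean_le => -[//|[i j] s] _ /=.
  by rewrite small eqxx lern1 leq_b1.
have [small|/negPf small] := boolP (enorm (gradf g xt) <= eps).
  apply: (@le_trans _ _ 1).
    rewrite -[X in _ <= X](word_mean_cst card_draw_gt0 m.+1).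
    by apply: word_mean_le => s _; rewrite lern1 leq_b1.
  rewrite -[X in X <= _](word_mean_cst card_draw_gt0 m.+2).
  by apply: word_mean_le => -[//|[i j] s] _ /=; rewrite small eqxx.
rewrite [X in X <= _]/= [X in _ <= X]/=.
rewrite ler_wpM2l ?invr_ge0 ?ler0n//; apply: ler_sum => -[i j] _.
have /negPf nb : ~~ brk n L beta ell k by apply: nbrk; lia.
rewrite small nb.
by apply: (IH k.+1 _ _ _); lia.
Qed.

(** Terminating before [ell] contributes 0 on the left. A run that enters [ell] restarts from [x0]
    with fresh draws, so [good] applies whatever came before; this is the conditional form of the
    success bound. *)
Lemma outer_success (q : R) ell : q <= 1 ->
  1 - q <= word_mean (Kt n L beta ell) (fun s : seq draw =>
    (enorm (gradf g (foldl (stepf ell) (x0, x0) s).2) <= eps)%R%:R : R) ->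
  forall m t k z xt cost, (t < ell)%N -> (k <= Kt n L beta t)%N ->
  m = ((Kt n L beta t - k).+1 + \sum_(t.+1 <= t' < ell.+1) (Kt n L beta t').+1)%N ->
  (1 - q) * word_mean m (fun s : seq draw =>
    (out_last (sim g L eps beta x0 ell s t k z xt cost) == ell)%:R : R) <=
  word_mean m (fun s : seq draw =>
    (out_term (sim g L eps beta x0 ell s t k z xt cost) == Some ell)%:R : R).
Proof.
move=> q1 good; elim=> [//|m IH] t k z xt cost tell kK mE.
have [bK nbrk] := Kt_spec t.
rewrite /= mulrCA ler_wpM2l ?invr_ge0 ?ler0n// mulr_sumr.
apply: ler_sum => -[i j] _.
have [small|/negPf small] := boolP (enorm (gradf g xt) <= eps).
  rewrite [out_last _]/= [out_term _]/= (inj_eq Some_inj) (ltn_eqF tell).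
  by rewrite (word_mean_cst card_draw_gt0) mulr0.
have [kE|kE] := eqVneq k (Kt n L beta t); last first.
  have kK' : (k < Kt n L beta t)%N by rewrite ltn_neqAle kE.
  have /negPf nb := nbrk _ kK'; rewrite nb.
  by apply: IH => //; lia.
rewrite kE bK tell.
have [tE|tE] := eqVneq t.+1 ell; last first.
  have tell' : (t.+1 < ell)%N by rewrite ltn_neqAle tE.
  apply: IH => //; move: mE; rewrite kE subnn (big_ltn (m := t.+1))//; lia.
(* The draws left are exactly those of the last loop, including the one for its final test. *)
have -> : m = (Kt n L beta ell).+1.
  by move: mE; rewrite kE subnn tE big_nat1; lia.
rewrite tE.
have := last_outer_success ell 0 (Kt n L beta ell) x0 x0 _ (add0n _).
move=> /(_ (cost + 2 + (if nat_of_ord j == 0 then n else 0) + n)%N).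
apply: le_trans; apply: le_trans good.
rewrite -[X in _ <= X]mulr1 ler_wpM2l ?subr_ge0//.
rewrite -[X in _ <= X](word_mean_cst card_draw_gt0 (Kt n L beta ell).+1).
by apply: word_mean_le => s _; rewrite lern1 leq_b1.
Qed.

End OuterLoops.

(** * Success probability and expected cost of a whole run *)

Section RunStatistics.
Context {R : realType} {d n : nat}.
Variables (L eps beta : R) (g : 'I_n -> 'rV[R]_d -> 'rV[R]_d) (x0 : 'rV[R]_d).
Hypotheses (L0 : 0 < L) (n0 : (0 < n)%N) (beta1 : 1 < beta).
Let draw : finType := ('I_n * 'I_n)%type.

Lemma Prob_word_mean ell (E : outcome -> bool) :
  Prob g L eps beta x0 ell E = word_mean (Ndraws n L beta ell)
    (fun s : seq draw => (E (sim g L eps beta x0 ell s 0 0 x0 x0 n))%:R).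
Proof. by rewrite -word_mean_ffun. Qed.

Lemma Expect_word_mean ell (X : outcome -> R) :
  Expect g L eps beta x0 ell X = word_mean (Ndraws n L beta ell)
    (fun s : seq draw => X (sim g L eps beta x0 ell s 0 0 x0 x0 n)).
Proof. by rewrite -word_mean_ffun. Qed.

Lemma Prob_success (q : R) ell : q <= 1 ->
  1 - q <= word_mean (Kt n L beta ell) (fun s : seq draw =>
    (enorm (gradf g (foldl (stepf L beta g x0 ell) (x0, x0) s).2) <= eps)%R%:R : R) ->
  (1 - q) * Prob g L eps beta x0 ell (fun o => out_last o == ell) <=
  Prob g L eps beta x0 ell (fun o => out_term o == Some ell).
Proof.
move=> q1 good; rewrite !Prob_word_mean /Ndraws -(big_mkord predT (fun t => (Kt n L beta t).+1)).
(* [outer_success] starts strictly before [ell]; for [ell = 0] the run is already in its last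
   loop. *)
have [ell0|ell_gt0] := posnP ell.
  have -> : (\sum_(0 <= t < ell.+1) (Kt n L beta t).+1 = (Kt n L beta ell).+1)%N.
    by rewrite ell0 big_nat1.
  have := last_outer_success L eps beta g x0 L0 n0 beta1 ell 0 (Kt n L beta ell) x0 x0 n (add0n _).
  rewrite {5}ell0.
  apply: le_trans; apply: le_trans good.
  rewrite -[X in _ <= X]mulr1 ler_wpM2l ?subr_ge0//.
  rewrite -[X in _ <= X](word_mean_cst (card_draw_gt0 n0) (Kt n L beta ell).+1).
  by apply: word_mean_le => s _; rewrite lern1 leq_b1.
apply: (outer_success L eps beta g x0 L0 n0 beta1 q ell q1 good) => //.
by rewrite subn0 [LHS]big_ltn.
Qed.

Definition draw_cost (ij : draw) : nat :=
  2 + (if nat_of_ord ij.2 == 0 then n else 0).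

(** Pathwise bound charging every draw, even those after termination, and [n] for each restart. *)
Lemma out_cost_sim_le ell (s : seq draw) t k z xt cost : (t <= ell)%N ->
  (out_cost (sim g L eps beta x0 ell s t k z xt cost)
     <= cost + \sum_(ij <- s) draw_cost ij + n * (ell - t))%N.
Proof.
elim: s t k z xt cost => [|[i j] s IH] t k z xt cost tell /=.
  by rewrite big_nil addn0 leq_addr.
rewrite big_cons {1}/draw_cost/=; move: (if _ then n else _)%N => e.
move: IH; move: (\sum_(ij <- s) _)%N => S IH.
have [_|_] := boolP (_ <= _)%R; first by move: (n * _)%N => T /=; lia.
have [_|_] := boolP (brk _ _ _ _ _); last first.
  by apply: leq_trans (IH _ _ _ _ _ tell) _; lia.
have [tell'|_] := ltnP t ell; last by move: (n * _)%N => T /=; lia.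
apply: leq_trans (IH _ _ _ _ _ tell') _.
have -> : (ell - t = (ell - t.+1).+1)%N by lia.
by rewrite mulnS; lia.
Qed.

Lemma Expect_cost_le ell :
  Expect g L eps beta x0 ell (fun o => (out_cost o)%:R) <=
  n%:R * ell.+1%:R + 3 * (Ndraws n L beta ell)%:R.
Proof.
rewrite Expect_word_mean.
pose F (s : seq draw) : R := (n * ell.+1)%:R + \sum_(ij <- s) (draw_cost ij)%:R.
apply: (@le_trans _ _ (word_mean (Ndraws n L beta ell) F)).
  apply: word_mean_le => s _; rewrite /F -natr_sum -natrD ler_nat.
  apply: leq_trans (out_cost_sim_le _ _ _ _ _ _ _ (leq0n _)) _.
  by rewrite subn0 mulnS; lia.
rewrite word_meanD (word_mean_cst (card_draw_gt0 n0)) (word_mean_sum (card_draw_gt0 n0)).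
rewrite natrM lerD2l mulrC ler_wpM2r ?ler0n//.
(* A draw costs 3 on average: 2 component gradients, and [n] more with probability [1 / n]. *)
have -> : \sum_ij (draw_cost ij)%:R = (3 * n * n)%:R :> R.
  rewrite -natr_sum; congr (_%:R).
  rewrite -(pair_bigA _ (fun i j => draw_cost (i, j)))/=.
  rewrite /draw_cost/= sum_nat_const card_ord big_split/= sum_nat_const card_ord.
  have -> : (\sum_(j < n) (if nat_of_ord j == 0 then n else 0) = n)%N.
    by move: (n) n0 => [//|m] _; rewrite big_ord_recl/= big1 ?addn0.
  lia.
by rewrite card_draw !natrM -mulrA mulrCA mulVf ?mulr1// mulf_neq0 ?pnatr_eq0 -?lt0n.
Qed.

End RunStatistics.

(** * Gradient norm at the end of an inner loop *)

Section RunConvergence.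
Context {R : realType} {d n : nat}.
Variables (L beta R0 : R) (f : 'I_n -> 'rV[R]_d -> R).
Variables (g : 'I_n -> 'rV[R]_d -> 'rV[R]_d) (x0 c : 'rV[R]_d) (t : nat).
Hypotheses (L0 : 0 < L) (n0 : (0 < n)%N) (beta1 : 1 < beta).
Hypothesis fsmooth : forall i, L_smooth L (f i) (g i).
Hypothesis fconv : forall i, convex_fun (f i).
Let dl := delta L beta t.
Let a := alpha n L beta t.
Let s := a + dl.
Let K := Kt n L beta t.
Let pot := potential L f g beta t c.
Hypothesis gradf_c : gradf g c = dl *: (x0 - c).
Hypothesis R00 : 0 < R0.
Hypothesis dist_c : dotv (x0 - c) (x0 - c) <= R0 ^+ 2.

Lemma word_mean_potential m zx :
  word_mean m (fun w => pot (foldl (stepf L beta g x0 t) zx w)) <=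
  ((a / s) ^+ 2) ^+ m * pot zx.
Proof.
elim: m zx => [|m IH] zx; first by rewrite expr0 mul1r.
rewrite [X in X <= _]/=.
apply: (@le_trans _ _ (#|{: 'I_n * 'I_n}|%:R^-1 * \sum_(ij : 'I_n * 'I_n)
    ((a / s) ^+ 2) ^+ m * pot (stepf L beta g x0 t zx ij))).
  by rewrite ler_wpM2l ?invr_ge0 ?ler0n//; apply: ler_sum => ij _; exact: IH.
rewrite -mulr_sumr mulrCA (exprSr _ m) -mulrA ler_wpM2l ?(exprn_ge0 _ (sqr_ge0 _))//.
have N0 : 0 < n%:R :> R by rewrite ltr0n.
rewrite [#|_|](@card_draw n) natrM ler_pdivrMl ?mulr_gt0//.
by case: zx => z x; apply: potential_step gradf_c _ _.
Qed.

Let dl0 : 0 < dl. Proof. exact: delta_gt0. Qed.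
Let a0 : 0 < a. Proof. exact: alpha_gt0. Qed.
Let s0 : 0 < s. Proof. by rewrite addr_gt0. Qed.

Lemma C_IDC_contraction : ((a / s) ^+ 2) ^+ K * C_IDC n L beta t <= dl ^+ 2.
Proof.
have [+ _] := Kt_spec L beta L0 n0 beta1 t.
rewrite /brk -/dl -/a -/K.
have -> : 1 + dl / a = s / a by rewrite /s; move: (a) (dl) a0 => a' dl' ?; field; rewrite gt_eqF.
have C0 : 0 <= C_IDC n L beta t.
  rewrite C_IDCE// -/dl -/a -/s addr_ge0 ?sqr_ge0// divr_ge0 ?mulr_ge0 ?sqr_ge0 ?addr_ge0//;
  exact: ltW.
have r0 : 0 <= (s / a) ^+ K * dl.
  exact: mulr_ge0 (exprn_ge0 _ (divr_ge0 (ltW s0) (ltW a0))) (ltW dl0).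
rewrite ler_pdivrMr// -ler_sqr ?nnegrE ?sqrtr_ge0//.
rewrite sqr_sqrtr// exprMn -!exprM (mulnC K) => H.
have asK : 0 < (a / s) ^+ (2 * K) by rewrite exprn_gt0// divr_gt0.
move: H; rewrite -(ler_pM2l asK) mulrA -exprMn.
have -> : a / s * (s / a) = 1 by move: (a) (s) a0 s0 => a' s' ? ?; field; rewrite !gt_eqF.
by rewrite expr1n mul1r.
Qed.

Lemma word_mean_sqr_gradf :
  word_mean K (fun w => let x := (foldl (stepf L beta g x0 t) (x0, x0) w).2 in
    dotv (gradf g x - gradf g c) (gradf g x - gradf g c)) <= dl ^+ 2 * R0 ^+ 2.
Proof.
have k0 : 0 < n%:R * (s + L) / L by rewrite divr_gt0// mulr_gt0 ?ltr0n ?addr_gt0.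
rewrite -(ler_pM2l k0) -word_meanZ.
apply: (@le_trans _ _ (word_mean K (fun w => pot (foldl (stepf L beta g x0 t) (x0, x0) w)))).
  by apply: word_mean_le => w _; exact: le_potential.
apply: le_trans (word_mean_potential _ _) _.
apply: (@le_trans _ _ (((a / s) ^+ 2) ^+ K *
    (n%:R * (s + L) / L * C_IDC n L beta t * dotv (x0 - c) (x0 - c)))).
  by rewrite ler_wpM2l ?(exprn_ge0 _ (sqr_ge0 _))//; exact: potential_init.
have D0 := dotv_ge0 (x0 - c).
have r0 : 0 <= ((a / s) ^+ 2) ^+ K by exact: exprn_ge0 (sqr_ge0 _).
have H := C_IDC_contraction.
rewrite -(mulrA (n%:R * (s + L) / L)) mulrCA ler_wpM2l ?(ltW k0)// mulrA.
apply: le_trans (ler_wpM2r D0 H) _.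
by rewrite ler_wpM2l ?sqr_ge0.
Qed.

(* Markov's inequality; the square root of the second moment is avoided by
   [2 e <= e^2 / (dl R0) + dl R0]. *)
Lemma word_mean_small_gradf (eps q : R) : 0 < eps -> dl <= eps * q / (2 * R0) ->
  1 - q <= word_mean K (fun w =>
    (enorm (gradf g (foldl (stepf L beta g x0 t) (x0, x0) w).2) <= eps)%R%:R).
Proof.
move=> eps0 dlq.
have r0 : 0 < dl * R0 by rewrite mulr_gt0.
pose G (x : 'rV[R]_d) := dotv (gradf g x - gradf g c) (gradf g x - gradf g c).
pose x_ w := (foldl (stepf L beta g x0 t) (x0, x0) w).2.
have T0 := card_draw_gt0 n0.
pose k := - ((2 * (dl * R0) * eps)^-1).
have D0 : 0 < 2 * (dl * R0) * eps := mulr_gt0 (mulr_gt0 (ltr0Sn _ 1) r0) eps0.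
have k_le0 : k <= 0 by rewrite oppr_le0 invr_ge0 ltW.
(* With [r = dl * R0], the function [1 - (3 r + G / r) / (2 eps)] minorizes the indicator and has
   mean at least [1 - 2 r / eps], hence at least [1 - q]. *)
apply: (@le_trans _ _ (word_mean K (fun w =>
   (1 - 3 / 2 * (dl * R0) / eps) + k * G (x_ w)))).
  rewrite word_meanD (word_mean_cst T0) word_meanZ.
  have H : k * (dl ^+ 2 * R0 ^+ 2) <= k * word_mean K (fun w => G (x_ w)).
    by rewrite ler_wnM2l//; exact: word_mean_sqr_gradf.
  apply: (@le_trans _ _ (1 - 3 / 2 * (dl * R0) / eps + k * (dl ^+ 2 * R0 ^+ 2)));
    last by rewrite lerD2l.
  have -> : 1 - 3 / 2 * (dl * R0) / eps + k * (dl ^+ 2 * R0 ^+ 2) =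
      1 - dl * (2 * R0) / eps.
    rewrite /k; move: (dl) dl0 R00 => dl' ? ?; field; rewrite !gt_eqF//.
  rewrite lerD2l lerN2 ler_pdivrMr// mulrC (mulrC q).
  by rewrite mulrC -ler_pdivlMr// mulr_gt0.
apply: word_mean_le => w _; rewrite -/(x_ w).
have [|big] := leP (enorm (gradf g (x_ w))) eps.
  move=> _; rewrite -[X in _ <= X]/(1 : R) -[X in _ <= X]addr0 lerD//.
    rewrite gerBl; apply: divr_ge0; last exact: ltW.
    by apply: mulr_ge0; [lra|exact: ltW].
  by rewrite mulr_le0_ge0// dotv_ge0.
have G0 : enorm (gradf g (x_ w) - gradf g c) ^+ 2 = G (x_ w) by exact: sqr_enorm.
have gc : enorm (gradf g c) <= dl * R0.
  rewrite gradf_c enormZ ?(ltW dl0)// ler_wpM2l ?(ltW dl0)//.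
  by rewrite enorm_leP// ltW.
have tri := enormD (gradf g (x_ w) - gradf g c) (gradf g c).
rewrite subrK in tri.
set e := enorm (_ - _) in tri G0.
set r := dl * R0 in r0 gc *.
(* Off the event, [2 r eps < 2 r e + 2 r^2 <= e^2 + 3 r^2], so the minorant is nonpositive. *)
have e0 : eps < e + r by apply: lt_le_trans big _; apply: le_trans tri _; rewrite lerD2l.
have -> : 1 - 3 / 2 * r / eps + k * G (x_ w) =
    (2 * r * eps - 3 * r ^+ 2 - e ^+ 2) / (2 * r * eps).
  by rewrite G0 /k -/r; move: (r) r0 => r' ?; field; rewrite !gt_eqF.
rewrite pmulr_lle0 ?invr_gt0//.
have : 0 <= (e - r) ^+ 2 := sqr_ge0 _.
nra.
Qed.
End RunConvergence.

(** * Number of inner iterations *)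

Section DrawCount.
Context {R : realType}.
Implicit Types L beta X : R.

Lemma ln2_le1 : ln 2 <= 1 :> R.
Proof. by have := @le_ln1Dx R 1; apply; lra. Qed.

(** The break test fails at the index before [Kt]; taking logarithms there bounds that index by
    [s / dl] times the logarithm of the threshold. *)
Lemma Kt_le n L beta t : (0 < n)%N -> 0 < L -> 1 < beta ->
  (Kt n L beta t)%:R <= 1 + (2 * n%:R + 2 * Num.sqrt (n%:R * beta ^+ t))
    * (1 + t%:R * ln beta).
Proof.
move=> n0 L0 beta1.
have [_ nbrk] := Kt_spec L beta L0 n0 beta1 t.
have lnb : 0 <= ln beta by rewrite ln_ge0 ?ltW.
have sn : 0 <= Num.sqrt (n%:R * beta ^+ t) by exact: sqrtr_ge0.
case: (Kt n L beta t) nbrk => [|k] nbrk.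
  by rewrite addr_ge0 ?mulr_ge0 ?addr_ge0 ?mulr_ge0.
have {nbrk} := nbrk k (ltnSn k); rewrite /brk -ltNge.
have dl0 := delta_gt0 L beta t L0 beta1; have a0 := alpha_gt0 n L beta t n0 L0 beta1.
have ratio := alpha_ratio_le n L beta t n0 L0 beta1.
have bt : L / delta L beta t = beta ^+ t.
  by rewrite /delta invfM invrK mulrA mulfV ?mul1r ?gt_eqF.
rewrite bt in ratio.
(* The threshold is at most [sqrt 3 * L / dl], rounded up to [2 * beta ^+ t]. *)
have sC : Num.sqrt (C_IDC n L beta t) / delta L beta t <= 2 * beta ^+ t.
  rewrite -bt mulrA ler_pM2r ?invr_gt0// -ler_sqr ?nnegrE ?sqrtr_ge0 ?mulr_ge0 ?(ltW L0)//.
  have C3 := C_IDC_le n L beta t n0 L0 beta1.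
  have L2 := sqr_ge0 L.
  have [C0|C0] := leP 0 (C_IDC n L beta t).
    by rewrite sqr_sqrtr// exprMn; lra.
  by rewrite ltr0_sqrtr// expr0n/= sqr_ge0.
move=> /lt_le_trans /(_ sC).
set a := alpha n L beta t in a0 ratio *; set dl := delta L beta t in dl0 ratio *.
have u0 : 0 < 1 + dl / a by rewrite addr_gt0// divr_gt0.
have b0 : 0 < beta by rewrite (lt_trans ltr01).
move=> lt2b.
have : ln ((1 + dl / a) ^+ k) < ln (2 * beta ^+ t).
  by rewrite ltr_ln// posrE ?exprn_gt0// mulr_gt0// exprn_gt0.
rewrite lnM ?posrE ?exprn_gt0// !lnXn//.
rewrite -[ln _ *+ k]mulr_natl -[ln beta *+ t]mulr_natl => H.
(* This is [ln (1 - v) <= - v] at [v = dl / (a + dl)]. *)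
have lnu : dl / (a + dl) <= ln (1 + dl / a).
  have -> : 1 + dl / a = (a / (a + dl))^-1.
    by rewrite invf_div mulrDl divff ?gt_eqF.
  have -> : a / (a + dl) = 1 + - (dl / (a + dl)).
    by rewrite -[in RHS](divff (lt0r_neq0 (addr_gt0 a0 dl0))) -mulNr -mulrDl addrK.
  have lt1 : dl / (a + dl) < 1 by rewrite ltr_pdivrMr ?addr_gt0// mul1r ltrDr.
  rewrite lnV ?posrE ?subr_gt0// lerNr; apply: le_ln1Dx; lra.
have := ln2_le1 => ln21.
have kle : k%:R * (dl / (a + dl)) <= 1 + t%:R * ln beta.
  apply: (@le_trans _ _ (k%:R * ln (1 + dl / a))); first by rewrite ler_wpM2l.
  lra.
rewrite -natr1 addrC lerD2l.
have s0 : 0 < (a + dl) / dl by rewrite divr_gt0// addr_gt0.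
apply: (@le_trans _ _ ((a + dl) / dl * (1 + t%:R * ln beta))).
  rewrite -ler_pdivrMl// mulrC invf_div; exact: kle.
by rewrite ler_wpM2r// addr_ge0 ?mulr_ge0.
Qed.

Lemma sum_expr_le (b : R) m : 1 < b -> \sum_(t < m.+1) b ^+ t <= b ^+ m * (b / (b - 1)).
Proof.
move=> b1; have b10 : 0 < b - 1 by rewrite subr_gt0.
rewrite mulrA ler_pdivlMr// mulrC -subrX1 -exprSr; lra.
Qed.

(** With the logarithmic factor bounded by [D] in all loops, the square-root parts form a geometric
    sum dominated by its last term, which saves a factor [ell]. *)
Lemma Ndraws_le n L beta ell (D : R) : (0 < n)%N -> 0 < L -> 1 < beta ->
  1 + ell%:R * ln beta <= D ->
  (Ndraws n L beta ell)%:R <= ell.+1%:R * (2 + 2 * n%:R * D)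
   + 2 * D * Num.sqrt n%:R * (Num.sqrt beta ^+ ell * (Num.sqrt beta / (Num.sqrt beta - 1))).
Proof.
move=> n0 L0 beta1 leD.
have lnb : 0 <= ln beta by rewrite ln_ge0 ?ltW.
have b1 : 1 < Num.sqrt beta by rewrite -{1}(sqrtr1 R) ltr_sqrt ?(lt_trans ltr01).
have D0 : 0 <= D by apply: le_trans leD; rewrite addr_ge0 ?mulr_ge0.
apply: (@le_trans _ _ (\sum_(t < ell.+1) ((2 + 2 * n%:R * D)
    + 2 * D * Num.sqrt n%:R * Num.sqrt beta ^+ t))).
  rewrite /Ndraws natr_sum; apply: ler_sum => t _.
  rewrite -natr1; have := Kt_le n L beta t n0 L0 beta1.
  have tD : 1 + t%:R * ln beta <= D.
    by apply: le_trans leD; rewrite lerD2l ler_wpM2r// ler_nat -ltnS.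
  have -> : Num.sqrt (n%:R * beta ^+ t) = Num.sqrt n%:R * Num.sqrt beta ^+ t.
    rewrite sqrtrM ?ler0n//; congr (_ * _).
    have b0 : 0 <= beta by lra.
    elim: (t : nat) => [|k IH]; first by rewrite !expr0 sqrtr1.
    by rewrite !exprS sqrtrM// IH.
  set Q := Num.sqrt n%:R * _ => H.
  have Q0 : 0 <= Q by rewrite mulr_ge0 ?exprn_ge0 ?sqrtr_ge0.
  have : (2 * n%:R + 2 * Q) * (1 + t%:R * ln beta) <= (2 * n%:R + 2 * Q) * D.
    by rewrite ler_wpM2l// addr_ge0 ?mulr_ge0.
  rewrite -(mulrA (2 * D)) -/Q; lra.
rewrite big_split/= sumr_const card_ord -[_ *+ _]mulr_natl lerD2l -mulr_sumr.
by rewrite ler_wpM2l ?sum_expr_le// !mulr_ge0 ?sqrtr_ge0.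
Qed.

End DrawCount.

(** * Assembly of both claims with a constant depending on [beta] only *)

Theorem theorem6 (R : realType) (beta : R) (hbeta : 1 < beta) :
  exists C : R, 0 < C /\
  forall (d n : nat) (f : 'I_n -> 'rV[R]_d -> R) (g : 'I_n -> 'rV[R]_d -> 'rV[R]_d)
         (L eps R0 q : R) (x0 xstar : 'rV[R]_d) (ell : nat),
    (0 < n)%N ->
    0 < L ->
    (forall i, convex_fun (f i)) ->
    (forall i, L_smooth L (f i) (g i)) ->
    (forall x, n%:R^-1 * \sum_(i < n) f i xstar <= n%:R^-1 * \sum_(i < n) f i x) ->
    0 < R0 ->
    enorm (x0 - xstar) <= R0 ->
    0 < eps ->
    0 < q < 1 ->
    eps * q / (2 * R0) <= L ->
    delta L beta ell <= eps * q / (2 * R0) ->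
    (forall t, (t < ell)%N -> eps * q / (2 * R0) < delta L beta t) ->
    (* (i) *)
    Prob g L eps beta x0 ell (fun o => out_term o == Some ell)
      >= (1 - q) * Prob g L eps beta x0 ell (fun o => out_last o == ell)
    /\
    (* (ii) *)
    let X := L * R0 / (eps * q) in
    let Lam := Num.max 1 (ln X) in
    Expect g L eps beta x0 ell (fun o => (out_cost o)%:R)
      <= C * ((n%:R * Lam + Num.sqrt (n%:R * X)) * Lam).

Proof.
have lnb : 0 < ln beta by rewrite ln_gt0.
have b1 : 1 < Num.sqrt beta by rewrite -{1}(sqrtr1 R) ltr_sqrt ?(lt_trans ltr01).
have ln2b : 0 <= ln (2 * beta) by apply: ln_ge0; lra.
(* Multiplied by [Lam], the constants [A], [D], [E] bound [ell * ln beta], [1 + ell * ln beta] and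
   [ell + 1]; [F] collects the geometric sum. *)
pose A := ln (2 * beta) + 1.
pose D := 1 + A.
pose E := A / ln beta + 1.
pose F := Num.sqrt (2 * beta) * (Num.sqrt beta / (Num.sqrt beta - 1)).
have A0 : 0 < A by rewrite /A; lra.
have D0 : 0 < D by rewrite /D; lra.
have E0 : 0 < E by rewrite /E addr_gt0 ?divr_gt0.
have F0 : 0 <= F by rewrite !mulr_ge0 ?sqrtr_ge0 ?invr_ge0 ?subr_ge0// ltW.
exists (7 * E + 6 * D * E + 6 * D * F); split.
  have := mulr_gt0 D0 E0; have := mulr_ge0 (ltW D0) F0; lra.
move=> d n f g L eps R0 q x0 xstar ell n0 L0 fconv fsmooth xmin R00 xR0 eps0
  /andP[q0 q1] dsL dell dlt.
split.
  (* Regularization 0 turns the optimality condition into [gradf g xstar = 0]. *)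
  have xsmin := gradf_regularized_min L f g L0 n0 fsmooth 0 x0 xstar (lexx 0).
  have gxs : gradf g xstar = 0.
    by rewrite xsmin ?scale0r// => x; rewrite !mul0r !addr0.
  have dl0 := delta_gt0 L beta ell L0 hbeta.
  have [c gc] := exists_regularized_min L f g L0 n0 fsmooth _ x0 xstar dl0 xmin.
  have cR0 : dotv (x0 - c) (x0 - c) <= R0 ^+ 2.
    apply: le_trans (dist_regularized_min L f g L0 n0 fsmooth fconv _ _ _ _ dl0 gc gxs) _.
    by rewrite -enorm_leP// ltW.
  apply: Prob_success => //; first exact: ltW.
  exact: (word_mean_small_gradf L beta R0 f g x0 c ell).
move=> X Lam.
have X0 : 0 < X := divr_gt0 (mulr_gt0 L0 R00) (mulr_gt0 eps0 q0).
have Lam1 : 1 <= Lam by rewrite le_max lexx.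
have lnX : ln X <= Lam by rewrite le_max lexx orbT.
have b0 : 0 < beta by rewrite (lt_trans ltr01).
have XE : eps * q / (2 * R0) = L / (2 * X).
  by rewrite /X; field; rewrite !gt_eqF.
(* Minimality of [ell] gives [beta^(ell - 1) < 2 X]; for [ell = 0] the bound [1 <= 2 X] comes from
   the threshold being at most [L]. *)
have bell : beta ^+ ell <= 2 * beta * X.
  case: (ell) dlt => [_|m dlt].
    have X2 : 1 <= 2 * X.
      have X20 : 0 < 2 * X by rewrite mulr_gt0.
      by rewrite -(ler_pM2l L0) mulr1 -ler_pdivrMr// -XE.
    by rewrite expr0 mulrAC (le_trans X2)// ler_peMr ?(ltW hbeta)// mulr_ge0// ltW.
  have X20 : 0 < 2 * X by rewrite mulr_gt0.
  have bm : 0 < beta ^+ m by exact: exprn_gt0.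
  have := dlt m (ltnSn m); rewrite XE /delta ltr_pM2l// ltf_pV2 ?posrE// => /ltW Xm.
  by rewrite exprS (mulrC 2) -mulrA ler_pM2l.
have ellA : ell%:R * ln beta <= A * Lam.
  have : ln (beta ^+ ell) <= ln (2 * beta * X).
    have bX0 : 0 < 2 * beta * X := mulr_gt0 (mulr_gt0 (ltr0Sn _ 1) b0) X0.
    by rewrite ler_ln ?posrE ?exprn_gt0.
  have -> : ln (2 * beta * X) = ln (2 * beta) + ln X.
    by apply: lnM; rewrite posrE// mulr_gt0.
  rewrite lnXn// -[ln beta *+ ell]mulr_natl /A => H.
  have : ln (2 * beta) <= ln (2 * beta) * Lam by rewrite ler_peMr.
  lra.
have ellE : ell.+1%:R <= E * Lam.
  have H : ell%:R <= A * Lam / ln beta by rewrite ler_pdivlMr.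
  by rewrite -natr1 /E mulrDl mul1r mulrAC; exact: lerD.
have sqb : Num.sqrt beta ^+ ell * (Num.sqrt beta / (Num.sqrt beta - 1)) <= F * Num.sqrt X.
  have sb : Num.sqrt beta ^+ ell <= Num.sqrt (2 * beta) * Num.sqrt X.
    have b2 : 0 <= 2 * beta by rewrite mulr_ge0// ltW.
    rewrite -ler_sqr ?nnegrE ?exprn_ge0 ?mulr_ge0 ?sqrtr_ge0//.
    by rewrite exprMn !sqr_sqrtr ?(ltW X0)// exprAC sqr_sqrtr ?(ltW b0).
  rewrite /F mulrAC; apply: ler_wpM2r sb.
  by rewrite divr_ge0 ?sqrtr_ge0// subr_ge0 ltW.
have DL : 1 + ell%:R * ln beta <= D * Lam.
  by rewrite /D mulrDl mul1r lerD.
apply: le_trans (Expect_cost_le L eps beta g x0 L0 n0 hbeta ell) _.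
have := Ndraws_le n L beta ell _ n0 L0 hbeta DL.
rewrite sqrtrM ?ler0n//.
have n1 : 1 <= n%:R :> R by rewrite ler1n.
set N := n%:R in n1 *; set sX := Num.sqrt X in sqb *; set sN := Num.sqrt N.
have sN0 : 0 <= sN by exact: sqrtr_ge0.
have sX0 : 0 <= sX by exact: sqrtr_ge0.
set G := _ * (Num.sqrt beta / _) in sqb *.
set M := (Ndraws _ _ _ _)%:R.
set l1 : R := ell.+1%:R in ellE *.
move=> HM; clearbody l1 M G sN sX N.
have DL0 : 0 <= D * Lam by apply: mulr_ge0; [exact: ltW | lra].
have H1 : l1 * (N + 6 + 6 * N * (D * Lam)) <= E * Lam * (N + 6 + 6 * N * (D * Lam)).
  apply: ler_wpM2r ellE; have : 0 <= N * (D * Lam) by rewrite mulr_ge0//; lra.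
  lra.
have H2 : D * Lam * sN * G <= D * Lam * sN * (F * sX).
  by apply: ler_wpM2l sqb; exact: mulr_ge0.
(* [N] and [Lam] are at least 1, so lower-order terms are absorbed into [N * Lam * Lam]. *)
have P1 : E * Lam <= E * (N * Lam * Lam).
  rewrite ler_pM2l// -mulrA; have : 1 * Lam <= N * (Lam * Lam); last by rewrite mul1r.
  by nra.
have P2 : E * Lam * N <= E * (N * Lam * Lam).
  rewrite -mulrA ler_pM2l// (mulrC Lam N) ler_peMr// mulr_ge0//; lra.
have Q0 : 0 <= (7 * E + 6 * D * E) * (sN * sX * Lam).
  rewrite !mulr_ge0//; last lra.
  have := mulr_gt0 D0 E0; lra.
have P0 : 0 <= D * F * (N * Lam * Lam).
  apply: mulr_ge0; first exact: mulr_ge0 (ltW D0) F0.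
  by apply: mulr_ge0; [apply: mulr_ge0|]; lra.
lra.
Qed.
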